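(* Let $\mathcal C$ be an updown category, let $\Bbbk$ be a field of characteristic $0$, and let $\Bbbk(\operatorname{Ob}\mathcal C)$ be the free $\Bbbk$-vector space on the set of objects of $\mathcal C$. Let $U,D:\Bbbk(\operatorname{Ob}\mathcal C)\to\Bbbk(\operatorname{Ob}\mathcal C)$ be the linear operators given on objects $p$ by $$Up=\sum_{|p'|=|p|+1}u(p;p')\,p',\qquad Dp=\begin{cases}\sum_{|p'|=|p|-1}d(p';p)\,p',&|p|>0,\\ 0,&p=\hat 0.\end{cases}$$ Then $U$ and $D$ are adjoint with respect to the inner product on $\Bbbk(\operatorname{Ob}\mathcal C)$ (symmetric bilinear form) defined on objects by $$\langle p,p'\rangle=\begin{cases}|\operatorname{Aut}(p)|,&\text{if }p'=p,\\ 0,&\text{otherwise;}\end{cases}$$ that is, $\langle Ux,y\rangle=\langle x,Dy\rangle$ for all $x,y\in\Bbbk(\operatorname{Ob}\mathcal C)$.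
   Context: An updown category is a small category $\mathcal C$ with a rank functor $|\cdot|:\mathcal C\to\mathbb N$ (where $\mathbb N=\{0,1,2,\dots\}$ is the ordered set of natural numbers regarded as a category) such that: (A1) each rank $\mathcal C_n=\{p\in\operatorname{Ob}\mathcal C:|p|=n\}$ is finite; (A2) $\mathcal C_0$ consists of a single object $\hat 0$, and $\operatorname{Hom}(\hat 0,p)$ is nonempty for all objects $p$; (A3) for objects $p,p'$, $\operatorname{Hom}(p,p')$ is always finite, and $\operatorname{Hom}(p,p')=\emptyset$ unless $|p|<|p'|$ or $p=p'$; in the latter case $\operatorname{Hom}(p,p)$ is a group, denoted $\operatorname{Aut}(p)$; (A4) any morphism $p\to p'$ with $|p'|=|p|+k$ factors as a composition $p=p_0\to p_1\to\cdots\to p_k=p'$ with $|p_{i+1}|=|p_i|+1$; (A5) if $|p'|=|p|+1$, the actions of $\operatorname{Aut}(p)$ and $\operatorname{Aut}(p')$ on $\operatorname{Hom}(p,p')$ (by precomposition and postcomposition respectively) are free. For objects $p,p'$ with $|p'|=|p|+1$, set $u(p;p')=|\operatorname{Hom}(p,p')/\operatorname{Aut}(p')|=|\operatorname{Hom}(p,p')|/|\operatorname{Aut}(p')|$ and $d(p;p')=|\operatorname{Hom}(p,p')/\operatorname{Aut}(p)|=|\operatorname{Hom}(p,p')|/|\operatorname{Aut}(p)|$. *)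

(* Defs.v *)
From HB Require Import structures.
From mathcomp Require Import all_boot all_order all_algebra.
From mathcomp Require Import finmap.
From mathcomp Require Import freeg.

Set Implicit Arguments.
Unset Strict Implicit.
Unset Printing Implicit Defensive.

Import GRing.Theory.
Local Open Scope ring_scope.

(* Only locally finite categories are needed, hence Hom-sets are finite types;
   [compm g f] is "g after f". *)
Record category := Category {
  Ob :> choiceType;
  Hom : Ob -> Ob -> finType;
  idm : forall p, Hom p p;
  compm : forall p q r, Hom q r -> Hom p q -> Hom p r;
  comp_idl : forall p q (f : Hom p q), compm (idm q) f = f;
  comp_idr : forall p q (f : Hom p q), compm f (idm p) = f;
  compA : forall p q r s (h : Hom r s) (g : Hom q r) (f : Hom p q),
    compm h (compm g f) = compm (compm h g) f
}.

Section Factorizations.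
Variables (C : category) (rk : C -> nat).

(* [factors k f] : f is a composite of k >= 1 morphisms, each of which raises
   the rank by exactly 1.                                                     *)
Inductive factors : nat -> forall p q : C, Hom p q -> Prop :=
| Factor1 p q (f : Hom p q) : rk q = (rk p).+1 -> factors 1 f
| FactorS k p q r (f : Hom p q) (g : Hom q r) :
    rk q = (rk p).+1 -> factors k g -> factors k.+1 (compm g f).

End Factorizations.

(* [objs n] is the finite set of the objects of rank n. All of Hom p p is
   required to be a group ([aut_inv]), so that Aut(p) is Hom p p. [hom_factors]
   has k > 0 because for k = 0 the morphism is an automorphism, which is not
   meant to be an empty composite, i.e. an identity.                          *)
Record updown := Updown {
  ucat :> category;
  rk : ucat -> nat;
  rk_functor : forall p q : ucat, Hom p q -> (rk p <= rk q)%N;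
  objs : nat -> {fset ucat};
  mem_objs : forall n p, (p \in objs n) = (rk p == n);
  zero_obj : ucat;
  rk_eq0 : forall p, rk p = 0%N <-> p = zero_obj;
  zero_hom : forall p, inhabited (Hom zero_obj p);
  hom_rk : forall p q : ucat, Hom p q -> (rk p < rk q)%N \/ p = q;
  aut_inv : forall (p : ucat) (a : Hom p p),
    exists b : Hom p p, compm b a = idm p /\ compm a b = idm p;
  hom_factors : forall k (p q : ucat) (f : Hom p q),
    (0 < k)%N -> rk q = (rk p + k)%N -> factors rk k f;
  aut_free_src : forall (p q : ucat) (f : Hom p q) (a : Hom p p),
    rk q = (rk p).+1 -> compm f a = f -> a = idm p;
  aut_free_tgt : forall (p q : ucat) (f : Hom p q) (b : Hom q q),
    rk q = (rk p).+1 -> compm b f = f -> b = idm q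
}.

Section Multiplicities.
Variable C : updown.
Implicit Types p q : C.

Definition Aut p : finType := Hom p p.

Definition orbits_tgt p q : {set {set Hom p q}} :=
  [set [set compm b f | b : Aut q] | f : Hom p q].

Definition orbits_src p q : {set {set Hom p q}} :=
  [set [set compm f a | a : Aut p] | f : Hom p q].

(* u(p;q) = |Hom(p,q)/Aut(q)| and d(p;q) = |Hom(p,q)/Aut(p)|; these are only
   used when |q| = |p| + 1.                                                   *)
Definition up_mult p q : nat := #|orbits_tgt p q|.
Definition down_mult p q : nat := #|orbits_src p q|.

End Multiplicities.

Section LinearExtension.
Variables (R : fieldType) (K : choiceType) (M : lmodType R) (f : K -> M).

HB.instance Definition _ :=
  GRing.isAdditive.Build {freeg K / R} M (fglift f) (lift_is_additive f).

Lemma fglift_scalable : scalable (fglift f).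
Proof.
move=> a x; rewrite -[in RHS](freeg_sumE x).
rewrite [a *: x]/(fgscale a x) /fgscale !raddf_sum.
by apply: eq_bigr => p _ /=; rewrite !liftU scalerA.
Qed.

HB.instance Definition _ :=
  GRing.isScalable.Build R {freeg K / R} M *:%R (fglift f) fglift_scalable.

End LinearExtension.

Section Operators.
Variables (C : updown) (k : fieldType).
Implicit Types (p q : C) (x y : {freeg C / k}).

Definition up_obj p : {freeg C / k} :=
  \sum_(q <- objs C (rk p).+1) (up_mult p q)%:R *: << q >>.

Definition down_obj p : {freeg C / k} :=
  if (0 < rk p)%N
  then \sum_(q <- objs C (rk p).-1) (down_mult q p)%:R *: << q >>
  else 0.

Definition form_obj p q : k := if q == p then #|Aut p|%:R else 0.

Definition up_op x : {freeg C / k} := fglift up_obj x.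
Definition down_op x : {freeg C / k} := fglift down_obj x.

Definition updown_form x y : k :=
  fglift (fun p => fglift (form_obj p : C -> k^o) y : k^o) x.

HB.instance Definition _ := GRing.Linear.copy up_op (fglift up_obj).
HB.instance Definition _ := GRing.Linear.copy down_op (fglift down_obj).

Lemma up_opE p : up_op << p >> = up_obj p.
Proof. by rewrite /up_op liftU scale1r. Qed.

Lemma down_opE p : down_op << p >> = down_obj p.
Proof. by rewrite /down_op liftU scale1r. Qed.

Lemma updown_formE p q : updown_form << p >> << q >> = form_obj p q.
Proof. by rewrite /updown_form !liftU !scale1r. Qed.

Lemma updown_form_linearl y a x x' :
  updown_form (a *: x + x') y = a * updown_form x y + updown_form x' y.
Proof. by rewrite /updown_form linearP. Qed.

Lemma updown_form_sumE x y :
  updown_form x y = \sum_(p <- dom x) \sum_(q <- dom y)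
    coeff p x * coeff q y * form_obj p q.
Proof.
rewrite /updown_form -[in LHS](freeg_sumE x) raddf_sum; apply: eq_bigr => p _.
rewrite /= liftU -[in LHS](freeg_sumE y) !raddf_sum.
by apply: eq_bigr => q _; rewrite /= liftU scalerA.
Qed.

Lemma updown_form_sym x y : updown_form x y = updown_form y x.
Proof.
rewrite !updown_form_sumE exchange_big.
apply: eq_bigr => q _; apply: eq_bigr => p _.
rewrite [coeff p x * _]mulrC /form_obj; congr (_ * _).
by rewrite eq_sym; case: eqP => // ->.
Qed.

End Operators.

(* Main.v *)
Require Import Defs.
From mathcomp Require Import all_boot all_order all_algebra finmap freeg.
(* [Hom] and [Aut] would otherwise refer to MathComp's notions. *)
Import GRing.Theory Defs.
Local Open Scope ring_scope.

(** By bilinearity it suffices to compare both sides on objects [p] and [q].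
    They vanish unless [|q| = |p| + 1], and then freeness of the actions gives
    [u(p;q) |Aut q| = |Hom(p,q)| = d(p;q) |Aut p|]. *)

(** By the first hypothesis the fibre of [F] over the value [F f] is the set [F f] itself, so [T]
    can be counted fibre by fibre. The intended [F] sends a morphism to its orbit. *)
Lemma card_uniform_classes {T : finType} (F : T -> {set T}) (n : nat) :
    (forall f g, (g \in F f) = (F g == F f)) -> (forall f, #|F f| = n) ->
  (#|[set F f | f : T]| * n)%N = #|T|.
Proof.
move=> mem_F card_F.
rewrite -[RHS]sum1_card (partition_big_imset F) /= -sum_nat_const.
apply: eq_bigr => A /imsetP[f _ ->].
rewrite -(card_F f) -sum1_card; apply: eq_bigl => g.
by rewrite mem_F.
Qed.

Section Multiplicities.
Variables (C : updown) (p q : C).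
Hypothesis rk_q : rk q = (rk p).+1.

(** Inverses in [Aut q] make the orbits a partition; freeness gives each orbit the size of
    [Aut q]. *)
Lemma up_mult_card : (up_mult p q * #|Aut q|)%N = #|Hom p q|.
Proof.
apply: card_uniform_classes => [f g|f].
  apply/imsetP/eqP => [[b _ ->]|eq_fg].
    have [c [cb bc]] := aut_inv b.
    apply/setP => h; apply/imsetP/imsetP => -[a _ ->].
      by exists (compm a b) => //; rewrite compA.
    by exists (compm a c) => //; rewrite compA -(compA a c b) cb comp_idr.
  have /imsetP[b _ ->] : g \in [set compm b f | b : Aut q].
    by rewrite -eq_fg; apply/imsetP; exists (idm q); rewrite ?comp_idl.
  by exists b.
rewrite card_imset // => a b eq_ab.
have [c [cb bc]] := aut_inv b.
(* Freeness concerns stabilizers only: since [a] and [b] send [f] to the same morphism, the inverse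
   [c] of [b] composed after [a] fixes [f]. *)
have ca : compm c a = idm q.
  by apply: (aut_free_tgt rk_q (f := f)); rewrite -compA eq_ab compA cb comp_idl.
by rewrite -[a]comp_idl -bc -compA ca comp_idr.
Qed.

(** Mirror image of [up_mult_card]: precomposition is a right action, so products with the inverse
    are taken in the opposite order. *)
Lemma down_mult_card : (down_mult p q * #|Aut p|)%N = #|Hom p q|.
Proof.
apply: card_uniform_classes => [f g|f].
  apply/imsetP/eqP => [[b _ ->]|eq_fg].
    have [c [cb bc]] := aut_inv b.
    apply/setP => h; apply/imsetP/imsetP => -[a _ ->].
      by exists (compm b a) => //; rewrite compA.
    by exists (compm c a) => //; rewrite compA -(compA f b c) bc comp_idr.
  have /imsetP[b _ ->] : g \in [set compm f b | b : Aut p].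
    by rewrite -eq_fg; apply/imsetP; exists (idm p); rewrite ?comp_idr.
  by exists b.
rewrite card_imset // => a b eq_ab.
have [c [cb bc]] := aut_inv b.
have ac : compm a c = idm p.
  by apply: (aut_free_src rk_q (f := f)); rewrite compA eq_ab -compA bc comp_idr.
by rewrite -[a]comp_idr -cb compA ac comp_idl.
Qed.

End Multiplicities.

Section Form.
Variables (C : updown) (k : fieldType).
Implicit Types (p q : C) (x y : {freeg C / k}).

Lemma updown_form_suml (I : Type) (s : seq I) (c : I -> k)
    (F : I -> {freeg C / k}) y :
  updown_form (\sum_(i <- s) c i *: F i) y
    = \sum_(i <- s) c i * updown_form (F i) y.
Proof.
elim: s => [|i s IHs]; first by rewrite !big_nil /updown_form raddf0.
by rewrite !big_cons updown_form_linearl IHs.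
Qed.

Lemma updown_form_sumr (I : Type) (s : seq I) (c : I -> k)
    (F : I -> {freeg C / k}) x :
  updown_form x (\sum_(i <- s) c i *: F i)
    = \sum_(i <- s) c i * updown_form x (F i).
Proof.
rewrite updown_form_sym updown_form_suml.
by apply: eq_bigr => i _; rewrite updown_form_sym.
Qed.

Lemma freeg_sumZE x : x = \sum_(p <- dom x) coeff p x *: << p >>.
Proof.
rewrite -[LHS]freeg_sumE; apply: eq_bigr => p _.
by apply/eqP/freeg_eqP => q; rewrite coeffZ !coeffU mul1r.
Qed.

(** Distinct objects are orthogonal, so only the term at [q] can survive, and it contributes u(p;q)
    |Aut q|. *)
Lemma updown_form_up_obj p q :
  updown_form (up_obj k p) << q >>
    = if rk q == (rk p).+1 then #|Hom p q|%:R else 0.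
Proof.
rewrite updown_form_suml -mem_objs.
case: ifP => q_in; last first.
  rewrite big_seq big1 // => r r_in; rewrite updown_formE /form_obj.
  by case: eqP => [eq_qr|_]; [rewrite -eq_qr q_in in r_in | rewrite mulr0].
rewrite (bigD1_seq q) //= big1 ?addr0 => [|r /negPf ne_rq].
  rewrite updown_formE /form_obj eqxx -natrM up_mult_card //.
  by apply/eqP; rewrite -mem_objs.
by rewrite updown_formE /form_obj eq_sym ne_rq mulr0.
Qed.

Lemma updown_form_down_obj p q :
  updown_form << p >> (down_obj k q)
    = if rk q == (rk p).+1 then #|Hom p q|%:R else 0.
Proof.
(* In rank 0 both sides vanish: [down_obj k q] is 0 there, and 0 is not a successor. *)
rewrite /down_obj; case: ltnP => [rk_gt0|]; last first.
  by rewrite leqn0 => /eqP ->; rewrite updown_form_sym /updown_form raddf0.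
(* Since [rk q] is positive, [.-1] is not truncated here, and the rank condition says that [p]
   indexes a term of the sum. *)
have -> : (rk q == (rk p).+1) = (p \in objs C (rk q).-1).
  by rewrite mem_objs -[in LHS](prednK rk_gt0) eqSS eq_sym.
rewrite updown_form_sumr.
case: ifP => p_in; last first.
  rewrite big_seq big1 // => r r_in; rewrite updown_formE /form_obj.
  by case: eqP => [eq_rp|_]; [rewrite eq_rp p_in in r_in | rewrite mulr0].
rewrite (bigD1_seq p) //= big1 ?addr0 => [|r /negPf ne_rp].
  rewrite updown_formE /form_obj eqxx -natrM down_mult_card //.
  by move: p_in; rewrite mem_objs => /eqP ->; rewrite prednK.
by rewrite updown_formE /form_obj ne_rp mulr0.
Qed.

End Form.

Theorem theorem2p1 (C : updown) (k : fieldType) (char0 : [pchar k] =i pred0)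
    (x y : {freeg C / k}) :
  updown_form (up_op x) y = updown_form x (down_op y).
Proof.
(* Expanding [x], and then [y], in the basis of objects reduces the identity to a pair of basis
   elements. *)
rewrite [x in LHS]freeg_sumZE [x in RHS]freeg_sumZE.
rewrite linear_sum updown_form_suml /=.
under eq_bigr do rewrite linearZ /= up_opE.
rewrite updown_form_suml; apply: eq_bigr => p _; congr (_ * _).
rewrite [y in LHS]freeg_sumZE [y in RHS]freeg_sumZE.
rewrite linear_sum /=.
under [in RHS]eq_bigr do rewrite linearZ /= down_opE.
rewrite !updown_form_sumr; apply: eq_bigr => q _.
by rewrite updown_form_up_obj updown_form_down_obj.
Qed.
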